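(* Let $N\in\mathbb{N}_0$ and $\gamma,\delta>-1$. Let $H^{(4)}$ be the $(N+1)\times(N+1)$ matrix with entries $$H^{(4)}_{m,n}=\frac{(1+\gamma)_{m+n}(1+\delta)_{2N-m-n}}{\sqrt{m!\,n!\,(N-m)!\,(N-n)!\,(1+\gamma)_m(1+\gamma)_n(1+\delta)_{N-m}(1+\delta)_{N-n}}},\qquad m,n\in\{0,1,\dots,N\}.$$ Then $H^{(4)}$ is unitarily equivalent, via the unitary mapping $U:\mathbb{C}^{N+1}\to L^2(\mathbb{R},d\mu)$ determined by $Ue_n=\hat P_n$ for all $n\in\{0,1,\dots,N\}$, to the operator $T_h$ of multiplication by $h$ on $L^2(\mathbb{R},d\mu)$ (i.e. $UH^{(4)}U^{-1}=T_h$), where $\mu$ is the finitely supported measure $$\mu=(1+\delta)_N\,N!\sum_{x=0}^{N}\frac{(2x+\gamma+\delta+1)(1+\gamma)_x}{(1+x+\gamma+\delta)_{N+1}(1+\delta)_x\,(N-x)!\,x!}\;\delta_x,$$ $$h(x)=\binom{2N+\gamma+\delta+1}{N-x},$$ and $$\hat P_n(x)=\sqrt{\frac{N!\,(1+\gamma)_n(1+\delta)_{N-n}}{n!\,(N-n)!\,(1+\delta)_N}}\;R_n(\lambda(x);\gamma,\delta,N),$$ for $x\in\{0,1,\dots,N\}$. Consequently, $$\operatorname{spec}(H^{(4)})=\left\{\binom{2N+\gamma+\delta+1}{x}\;\middle|\;x\in\{0,1,\dots,N\}\right\}.$$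
   Context: $\mathbb{N}_0=\{0,1,2,\dots\}$; $\{e_0,\dots,e_N\}$ is the standard basis of $\mathbb{C}^{N+1}$; $(a)_n=a(a+1)\cdots(a+n-1)$, $(a)_0=1$, is the Pochhammer symbol; $\delta_x$ (with index $x$) is the unit mass Dirac measure supported at the point $x$ (whereas $\delta$ is a real parameter); for real $a$ and $j\in\mathbb{N}_0$, $\binom{a}{j}=\frac{a(a-1)\cdots(a-j+1)}{j!}$. Dual Hahn polynomials, for $n\in\{0,1,\dots,N\}$: $\displaystyle R_n(\lambda(x);\gamma,\delta,N)={}_3F_2\!\left(-n,-x,x+\gamma+\delta+1;\gamma+1,-N\,|\,1\right)=\sum_{j=0}^{n}\frac{(-n)_j(-x)_j(x+\gamma+\delta+1)_j}{(\gamma+1)_j(-N)_j\,j!}$, where $\lambda(x)=x(x+\gamma+\delta+1)$. In the weight of $\mu$ at $x=0$, if $\gamma+\delta+1=0$, the quotient $\frac{\gamma+\delta+1}{(1+\gamma+\delta)_{N+1}}$ is understood as its continuous extension $\frac{1}{(2+\gamma+\delta)_N}$. *)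

(* Defs.v *)
From HB Require Import structures.
From mathcomp Require Import all_boot all_order all_algebra ring lra.
From mathcomp Require Import complex.
From mathcomp Require Import all_classical all_reals all_analysis.
From mathcomp Require Import measurable_realfun.

Set Implicit Arguments.
Unset Strict Implicit.
Unset Printing Implicit Defensive.

Import Order.TTheory GRing.Theory Num.Theory.
Import numFieldNormedType.Exports.

Local Open Scope classical_set_scope.
Local Open Scope ring_scope.
Local Open Scope quotient_scope.
Local Open Scope complex_scope.

Section ComplexL2.
Context d (T : measurableType d) (R : realType).
Variable mu : {measure set T -> \bar R}.

Definition measurableC (f : T -> R[i]) :=
  measurable_fun setT (fun x => complex.Re (f x)) /\
  measurable_fun setT (fun x => complex.Im (f x)).

Definition cintegral (f : T -> R[i]) : R[i] :=
  (\int[mu]_x complex.Re (f x)) +i* (\int[mu]_x complex.Im (f x)).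

Definition sq_integrable : {pred T -> R[i]} := fun f =>
  `[< measurableC f /\
      (\int[mu]_x (Normc.normc (f x) ^+ 2)%:E < +oo)%E >].

Lemma sqr_normc (z : R[i]) :
  Normc.normc z ^+ 2 = complex.Re z ^+ 2 + complex.Im z ^+ 2.
Proof. by case: z => a b /=; rewrite sqr_sqrtr // addr_ge0 // sqr_ge0. Qed.

Lemma measurableC_normc2 f : measurableC f ->
  measurable_fun setT (fun x => Normc.normc (f x) ^+ 2).
Proof.
move=> [mr mi].
under eq_fun do rewrite sqr_normc.
by apply: measurable_funD; apply: measurable_funX.
Qed.

Lemma measurableCM f g : measurableC f -> measurableC g ->
  measurableC (fun x => f x * g x).
Proof.
move=> [fr fi] [gr gi].
have ReM (a b : R[i]) : complex.Re (a * b) =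
    complex.Re a * complex.Re b - complex.Im a * complex.Im b.
  by case: a b => ? ? [].
have ImM (a b : R[i]) : complex.Im (a * b) =
    complex.Re a * complex.Im b + complex.Im a * complex.Re b.
  by case: a b => ? ? [].
split.
  under eq_fun do rewrite ReM.
  by apply: measurable_funB; exact: measurable_funM.
under eq_fun do rewrite ImM.
by apply: measurable_funD; exact: measurable_funM.
Qed.

Lemma measurableC_conj f : measurableC f -> measurableC (fun x => (f x)^*).
Proof.
move=> [fr fi]; split.
  rewrite [X in measurable_fun _ X](_ : _ = fun x => complex.Re (f x)) //.
  by apply/funext => x; case: (f x).
rewrite [X in measurable_fun _ X](_ : _ = \- (fun x => complex.Im (f x))).
  exact: measurable_funN.
by apply/funext => x /=; case: (f x).
Qed.

Lemma sq_integrable_submod : submod_closed sq_integrable.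
Proof.
split.
  apply/asboolP; split; first by split; apply: measurable_cst.
  under eq_integral do rewrite /= expr0n /= addr0 sqrtr0 expr0n /=.
  by rewrite integral0 ltry.
move=> a f g /asboolP[[fr fi] fo] /asboolP[[gr gi] go]; apply/asboolP.
have Re_af x : complex.Re ((a *: f + g) x) =
    complex.Re a * complex.Re (f x) - complex.Im a * complex.Im (f x)
    + complex.Re (g x).
  rewrite /GRing.add /GRing.scale /=.
  by case: a (f x) (g x) => ? ? [? ?] [? ?].
have Im_af x : complex.Im ((a *: f + g) x) =
    complex.Re a * complex.Im (f x) + complex.Im a * complex.Re (f x)
    + complex.Im (g x).
  rewrite /GRing.add /GRing.scale /=.
  by clear Re_af; case: a (f x) (g x) => ? ? [? ?] [? ?].
have mafg : measurableC (a *: f + g).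
  split.
    under eq_fun do rewrite Re_af.
    apply: measurable_funD => //; apply: measurable_funB;
      by apply: measurable_funM => //; apply: measurable_cst.
  under eq_fun do rewrite Im_af.
  apply: measurable_funD => //; apply: measurable_funD;
    by apply: measurable_funM => //; apply: measurable_cst.
split=> //.
pose F x := ((2 * Normc.normc a ^+ 2)%:E * (Normc.normc (f x) ^+ 2)%:E +
             2%:E * (Normc.normc (g x) ^+ 2)%:E)%E.
have /measurable_EFinP mf := measurableC_normc2 (conj fr fi).
have /measurable_EFinP mg := measurableC_normc2 (conj gr gi).
apply: (@le_lt_trans _ _ (\int[mu]_x F x)%E).
  apply: ge0_le_integral => //.
  - by move=> x _; rewrite lee_fin sqr_ge0.
  - exact/measurable_EFinP/measurableC_normc2.
  - by apply: emeasurable_funD; apply: emeasurable_funM => //;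
      apply: measurable_cst.
  - move=> x _; rewrite /F -!EFinM -EFinD lee_fin !sqr_normc Re_af Im_af.
    move: (complex.Re a) (complex.Im a) (complex.Re (f x)) (complex.Im (f x))
      (complex.Re (g x)) (complex.Im (g x)) => p q r s t u.
    rewrite -subr_ge0.
    have -> : 2 * (p ^+ 2 + q ^+ 2) * (r ^+ 2 + s ^+ 2) +
       2 * (t ^+ 2 + u ^+ 2) - ((p * r - q * s + t) ^+ 2 +
       (p * s + q * r + u) ^+ 2) =
       (p * r - q * s - t) ^+ 2 + (p * s + q * r - u) ^+ 2 by ring.
    by rewrite addr_ge0 ?sqr_ge0.
rewrite /F ge0_integralD //=; last first.
- by apply: emeasurable_funM => //; apply: measurable_cst.
- by move=> x _; rewrite -EFinM lee_fin mulr_ge0 ?sqr_ge0.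
- by apply: emeasurable_funM => //; apply: measurable_cst.
- by move=> x _; rewrite -EFinM lee_fin; apply/mulr_ge0/sqr_ge0;
    exact/mulr_ge0/sqr_ge0.
rewrite !ge0_integralZl_EFin //; first last.
- by rewrite mulr_ge0 ?sqr_ge0.
- by move=> x _; rewrite lee_fin sqr_ge0.
- by move=> x _; rewrite lee_fin sqr_ge0.
by rewrite lte_add_pinfty // lte_mul_pinfty // lee_fin mulr_ge0 ?sqr_ge0.
Qed.

HB.instance Definition _ :=
  GRing.isSubmodClosed.Build _ _ sq_integrable sq_integrable_submod.

Record L2fun := MkL2fun {
  L2fun_val :> T -> R[i];
  L2funP : L2fun_val \in sq_integrable }.

HB.instance Definition _ := [isSub for L2fun_val].
HB.instance Definition _ := gen_eqMixin L2fun.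
HB.instance Definition _ := [Choice of L2fun by <:].
HB.instance Definition _ := [SubChoice_isSubLmodule of L2fun by <:].

Definition ae_zero : {pred L2fun} := fun f =>
  `[< {ae mu, forall x, f x = 0} >].

Lemma ae_zero_zmod : zmod_closed ae_zero.
Proof.
split; first by apply/asboolP; apply: nearW.
move=> f g /asboolP f0 /asboolP g0; apply/asboolP.
near=> x; have -> : (f - g) x = f x - g x by [].
by rewrite (near f0 x) // (near g0 x) // subrr.
Unshelve. all: by end_near. Qed.

HB.instance Definition _ := GRing.isZmodClosed.Build _ ae_zero ae_zero_zmod.

(* Square-integrable functions modulo functions vanishing mu-almost everywhere. *)
Definition L2 : Type := Quotient.quot ae_zero.
HB.instance Definition _ := Choice.on L2.
HB.instance Definition _ := GRing.Zmodule.on L2.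
HB.instance Definition _ := Quotient.on L2.

Definition L2class (f : L2fun) : L2 := \pi_L2 f.

Lemma L2classP (f g : L2fun) :
  L2class f = L2class g <-> {ae mu, forall x, f x = g x}.
Proof.
have -> : L2class f = L2class g <-> f - g \in ae_zero.
  by rewrite Quotient.idealrBE; split => /eqP.
split => [/asboolP|] h; last apply/asboolP; near=> x.
  by apply/eqP; rewrite -subr_eq0; apply/eqP; exact: (near h x).
by rewrite [LHS](_ : _ = f x - g x) // (near h x) // subrr.
Unshelve. all: by end_near. Qed.

Lemma L2classK (F : L2) : L2class (repr F) = F.
Proof. exact: reprK. Qed.

Lemma L2classD : {morph L2class : f g / f + g}.
Proof. by move=> f g; rewrite /L2class !piE. Qed.

Definition L2scale (a : R[i]) (F : L2) : L2 := L2class (a *: repr F).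

Lemma L2scaleE a f : L2scale a (L2class f) = L2class (a *: f).
Proof.
apply/L2classP; have /L2classP h := L2classK (L2class f).
near=> x; rewrite [LHS](_ : _ = a *: (repr (L2class f) : L2fun) x) //.
by rewrite (near h x).
Unshelve. all: by end_near. Qed.

Lemma L2scaleA a b F : L2scale a (L2scale b F) = L2scale (a * b) F.
Proof. by rewrite -[F]L2classK !L2scaleE scalerA. Qed.

Lemma L2scale1 : left_id 1 L2scale.
Proof. by move=> F; rewrite -[F]L2classK L2scaleE scale1r. Qed.

Lemma L2scaleDr : right_distributive L2scale +%R.
Proof.
move=> a F G; rewrite -[F]L2classK -[G]L2classK -L2classD !L2scaleE.
by rewrite scalerDr L2classD.
Qed.

Lemma L2scaleDl F : {morph L2scale^~ F : a b / a + b}.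
Proof. by move=> a b; rewrite -[F]L2classK !L2scaleE scalerDl L2classD. Qed.

HB.instance Definition _ := GRing.Zmodule_isLmodule.Build R[i] L2
  L2scaleA L2scale1 L2scaleDr L2scaleDl.

(* Sesquilinear, linear in the first argument; L2dotE: independent of the
   representatives. *)
Definition L2dot (F G : L2) : R[i] :=
  cintegral (fun x => (repr F : L2fun) x * ((repr G : L2fun) x)^*).

Lemma L2fun_measurable (f : L2fun) : measurableC f.
Proof. by have /asboolP[] := L2funP f. Qed.

Lemma L2dotE (f g : L2fun) :
  L2dot (L2class f) (L2class g) = cintegral (fun x => f x * (g x)^*).
Proof.
have mh (f1 g1 : L2fun) : measurableC (fun x => f1 x * (g1 x)^*).
  apply: measurableCM (L2fun_measurable f1) _.
  by have [gr gi] := L2fun_measurable g1; exact: measurableC_conj.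
have e : {ae mu, forall x, (repr (L2class f) : L2fun) x *
    ((repr (L2class g) : L2fun) x)^* = f x * (g x)^*}.
  have /L2classP ef := L2classK (L2class f).
  have /L2classP eg := L2classK (L2class g).
  by near=> x; rewrite (near ef x) // (near eg x).
have [ar ai] := mh (repr (L2class f)) (repr (L2class g)).
have [br bi] := mh f g.
congr Complex; congr fine; apply: ae_eq_integral => //;
  (try exact/measurable_EFinP); by near=> x => _ /=; rewrite (near e x).
Unshelve. all: by end_near. Qed.

Record bmfun := MkBmfun {
  bm_val :> T -> R;
  bm_measurable : measurable_fun setT bm_val;
  bm_bounded : exists M, forall x, `|bm_val x| <= M }.

Lemma bmul_sq_integrable (h : bmfun) (f : L2fun) :
  (fun x => (h x)%:C * f x) \in sq_integrable.
Proof.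
have /asboolP[mf fo] := L2funP f.
have mhf : measurableC (fun x => (h x)%:C * f x).
  apply: measurableCM => //; split; first exact: bm_measurable.
  exact: measurable_cst.
apply/asboolP; split=> //.
have [M hM] := bm_bounded h.
have mn : measurable_fun setT (fun x => (Normc.normc (f x) ^+ 2)%:E).
  exact/measurable_EFinP/measurableC_normc2.
apply: (@le_lt_trans _ _
  (\int[mu]_x ((M ^+ 2)%:E * (Normc.normc (f x) ^+ 2)%:E))%E).
  apply: ge0_le_integral => //.
  - by move=> x _; rewrite lee_fin sqr_ge0.
  - exact/measurable_EFinP/measurableC_normc2.
  - by apply: emeasurable_funM => //; exact: measurable_cst.
  - move=> x _; rewrite -EFinM lee_fin Normc.normcM exprMn.
    apply: ler_wpM2r; first exact: sqr_ge0.
    rewrite sqr_normc /= expr0n addr0 -real_normK ?num_real //.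
    by rewrite ler_sqr ?nnegrE // (le_trans _ (hM x)).
rewrite ge0_integralZl_EFin ?sqr_ge0 //; last first.
  by move=> x _; rewrite lee_fin sqr_ge0.
by rewrite lte_mul_pinfty // lee_fin sqr_ge0.
Qed.

Definition bmul h f : L2fun := MkL2fun (bmul_sq_integrable h f).

(* Bounded multipliers act on the whole of L2; L2mulE: independent of the
   representative. *)
Definition L2mul (h : bmfun) (F : L2) : L2 := L2class (bmul h (repr F)).

Lemma L2mulE h f : L2mul h (L2class f) = L2class (bmul h f).
Proof.
apply/L2classP; have /L2classP e := L2classK (L2class f).
by near=> x; rewrite /= (near e x).
Unshelve. all: by end_near. Qed.

End ComplexL2.

Definition poch (R : pzRingType) (a : R) (n : nat) : R :=
  \prod_(i < n) (a + i%:R).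

Definition gbinom (R : fieldType) (a : R) (j : nat) : R :=
  (\prod_(i < j) (a - i%:R)) / j`!%:R.

Definition spec (R : rcfType) n (A : 'M[R[i]]_n) : set R[i] :=
  [set z | z%:M - A \notin unitmx].

Definition cdot (R : rcfType) n (u v : 'cV[R[i]]_n) : R[i] :=
  \sum_i u i 0 * (v i 0)^*.

Section DualHahn.
Variables (R : realType) (N : nat) (gamma delta : R).

Definition H4 : 'M[R[i]]_N.+1 := \matrix_(m, n)
  (poch (1 + gamma) (m + n)%N * poch (1 + delta) (2 * N - m - n)%N /
   Num.sqrt (m`!%:R * n`!%:R * (N - m)%N`!%:R * (N - n)%N`!%:R *
     poch (1 + gamma) m * poch (1 + gamma) n *
     poch (1 + delta) (N - m)%N * poch (1 + delta) (N - n)%N))%:C.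

(* R_n(lambda(x); gamma, delta, N) as a function of x, where
   lambda(x) = x (x + gamma + delta + 1): each product
   (-x)_j (x + gamma + delta + 1)_j is a polynomial in lambda(x). *)
Definition dual_hahn (n : nat) (x : R) : R :=
  \sum_(j < n.+1)
    poch (- n%:R) j * poch (- x) j * poch (x + gamma + delta + 1) j /
    (poch (gamma + 1) j * poch (- N%:R) j * j`!%:R).

(* Defined at every real x by the formula for x in {0, ..., N}. *)
Definition Phat_fun (n : nat) (x : R) : R :=
  Num.sqrt (N`!%:R * poch (1 + gamma) n * poch (1 + delta) (N - n)%N /
    (n`!%:R * (N - n)%N`!%:R * poch (1 + delta) N)) * dual_hahn n x.

(* (2x + gamma + delta + 1) / (1 + x + gamma + delta)_(N+1), with the value at
   x = 0 extended continuously to gamma + delta + 1 = 0, where the totalized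
   division would give 0. *)
Definition weight_quot (x : nat) : R :=
  if (x == 0%N) && (gamma + delta + 1 == 0) then (poch (2 + gamma + delta) N)^-1
  else (2 * x%:R + gamma + delta + 1) / poch (1 + x%:R + gamma + delta) N.+1.

Definition weight (x : nat) : R :=
  weight_quot x * poch (1 + gamma) x /
  (poch (1 + delta) x * (N - x)%N`!%:R * x`!%:R).

(* Only the values on the support {0, ..., N} of the measure matter; elsewhere
   the function is 0. *)
Definition h4_fun (x : R) : R :=
  \sum_(k < N.+1)
    gbinom (2 * N%:R + gamma + delta + 1) (N - k)%N * \1_[set k%:R] x.

Lemma h4_funE (k : nat) : (k <= N)%N ->
  h4_fun k%:R = gbinom (2 * N%:R + gamma + delta + 1) (N - k)%N.
Proof.
rewrite -ltnS => kN; rewrite /h4_fun (bigD1 (Ordinal kN)) //= indicE mem_set //.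
rewrite mulr1 big1 ?addr0 // => i /eqP ik; rewrite indicE memNset ?mulr0 //.
by move=> /= /eqP; rewrite eqr_nat => /eqP ki; apply: ik; exact/val_inj.
Qed.

Lemma h4_measurable : measurable_fun setT h4_fun.
Proof.
apply: measurable_sum => k; apply: measurable_funM.
  exact: measurable_cst.
exact: measurable_indic.
Qed.

Lemma h4_bounded : exists M, forall x, `|h4_fun x| <= M.
Proof.
exists (\sum_(k < N.+1)
  `|gbinom (2 * N%:R + gamma + delta + 1) (N - k)%N|) => x.
apply: le_trans (ler_norm_sum _ _ _) _; apply: ler_sum => k _.
by rewrite normrM ler_piMr // indicE; case: (_ \in _);
  rewrite ?normr1 ?normr0.
Qed.

Definition h4 : bmfun R R := MkBmfun h4_measurable h4_bounded.

Hypotheses (gamma_gt : -1 < gamma) (delta_gt : -1 < delta).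

Lemma poch_ge0 (a : R) n : 0 <= a -> 0 <= poch a n.
Proof. by move=> a0; apply: prodr_ge0 => i _; rewrite addr_ge0. Qed.

Lemma weight_quot_ge0 x : 0 <= weight_quot x.
Proof.
rewrite /weight_quot; case: x => [|x] /=.
  case: ifPn => [_|s0].
    by rewrite invr_ge0 poch_ge0 //; move: gamma_gt delta_gt; lra.
  rewrite /poch big_ord_recl /=.
  have -> : 2 * 0 + gamma + delta + 1 = 1 + 0 + gamma + delta + 0 by ring.
  rewrite invfM mulrA divff ?mul1r; last first.
    by apply: contra s0 => /eqP h; apply/eqP; rewrite -[RHS]h; ring.
  rewrite invr_ge0; apply: prodr_ge0 => i _.
  by rewrite /bump /= natrD; have : 0 <= i%:R :> R by [];
    move: gamma_gt delta_gt; lra.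
have x0 : 0 <= x%:R :> R by [].
by apply: divr_ge0; [|apply: poch_ge0]; rewrite -natr1;
  move: gamma_gt delta_gt x0; lra.
Qed.

Lemma weight_ge0 x : 0 <= weight x.
Proof.
have [g0 d0] : 0 <= 1 + gamma /\ 0 <= 1 + delta by move: gamma_gt delta_gt; split; lra.
apply: divr_ge0; first by rewrite mulr_ge0 ?weight_quot_ge0 ?poch_ge0.
by rewrite !mulr_ge0 ?poch_ge0.
Qed.

Lemma mass_ge0 : 0 <= poch (1 + delta) N * N`!%:R.
Proof. by rewrite mulr_ge0 ?poch_ge0 //; move: delta_gt; lra. Qed.

Definition mu4 : {measure set R -> \bar R} :=
  mscale (NngNum mass_ge0)
    (msum (fun x : nat => mscale (NngNum (weight_ge0 x)) \d_(x%:R : R)) N.+1).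

Lemma mu4E A : mu4 A = ((poch (1 + delta) N * N`!%:R)%:E *
  \sum_(x < N.+1) (weight x)%:E * \d_(x%:R : R) A)%E.
Proof. by []. Qed.

Lemma Phat_measurable n : measurable_fun setT (Phat_fun n).
Proof.
apply: measurable_funM; first exact: measurable_cst.
apply: measurable_sum => j; apply: measurable_funM; last exact: measurable_cst.
have mp (f : R -> R) : measurable_fun setT f ->
    measurable_fun setT (fun x => poch (f x) j).
  move=> mf; apply: measurable_prod => i _; apply: measurable_funD => //.
apply: measurable_funM; first apply: measurable_funM => //.
- by apply: (mp (fun x => - x)); exact: oppr_measurable.
- apply: (mp (fun x => x + gamma + delta + 1)); do 3 (apply: measurable_funD; last exact: measurable_cst).
  exact: measurable_id.
Qed.

Lemma Phat_sq_integrable n :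
  (fun x => (Phat_fun n x)%:C) \in sq_integrable mu4.
Proof.
have mP : measurableC (fun x : R => (Phat_fun n x)%:C).
  by split; [exact: Phat_measurable | exact: measurable_cst].
apply/asboolP; split => //.
have /measurable_EFinP mN := measurableC_normc2 mP.
have N0 (x : R) : True ->
    (0 <= (Normc.normc (Phat_fun n x)%:C ^+ 2)%:E)%E.
  by move=> _; rewrite lee_fin sqr_ge0.
rewrite ge0_integral_mscale // lte_mul_pinfty ?lee_fin ?mass_ge0 //.
rewrite ge0_integral_measure_sum //; apply: lte_sum_pinfty => x _.
rewrite ge0_integral_mscale // lte_mul_pinfty ?lee_fin ?weight_ge0 //.
by rewrite integral_dirac // diracT mul1e ltry.
Qed.

Definition Phat (n : nat) : L2 mu4 := L2class (MkL2fun (Phat_sq_integrable n)).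

End DualHahn.

(* Main.v *)
Require Import Defs.
From HB Require Import structures.
From mathcomp Require Import all_boot all_order all_algebra ring lra zify.
From mathcomp Require Import complex.
From mathcomp Require Import all_classical all_reals all_analysis.
From mathcomp Require Import measurable_realfun.

Set Implicit Arguments.
Unset Strict Implicit.
Unset Printing Implicit Defensive.

Import Order.TTheory GRing.Theory Num.Theory.
Import numFieldNormedType.Exports.

Local Open Scope classical_set_scope.
Local Open Scope ring_scope.
Local Open Scope complex_scope.

(** The columns of the matrix P with entries P(n, x) = Phat_n(x), for n and x
    in {0, ..., N}, are eigenvectors of the real symmetric matrix H4, and the
    eigenvalues h(x) = binomial(2N + gamma + delta + 1, N - x) are distinct.
    Everything else follows from these two facts and one linear identity for
    the weights.

    Eigenvectors.  Write s = gamma + delta + 1.  After the square roots are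
    cleared, H4 P = P diag(h) is, for the dual Hahn polynomials R_n,
      sum_m C(N,m) (gamma+1+n)_m (delta+1+N-n)_(N-m) R_m(x) = N! h(x) R_n(x)
    ([dual_hahn_eigen]).  The Chu-Vandermonde formula carries out the sum over
    m and leaves a terminating 3F2 series, which a second and a third use of
    the same formula transform into h(x) R_n(x); this is the Thomae-Sheppard
    transformation, with the upper parameter gamma+1+n and the lower one
    gamma+1 differing by the integer n.

    Orthogonality.  A symmetric matrix has orthogonal eigenvectors for
    distinct eigenvalues, so P^T P = diag(g) with every g_x > 0, and therefore
    P diag(1/g) P^T = 1 ([Phat_gram_diag], [Phat_completeness]).  The norms
    g_x are found by uniqueness: since P is invertible and P(0, x) = 1, the
    vector 1/g is the only solution v of sum_x P(n, x) v_x = [n = 0].  So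
    mu({x}) = 1/g_x as soon as the masses of mu solve this system too
    ([Phat_mean]).

    The masses.  Expanding R_n, the system reduces to
    the moments of mu against C(x,j) (x+s)_j, which must be
    C(N,j) (gamma+1)_j ([momentE]), because then sum_j (-1)^j C(n,j) = [n = 0]
    remains.  A telescoping sum gives a two-term recurrence between
    consecutive moments ([gosper_partial_sum], [momentS]), and the moment
    j = N has the single term x = N, so the recurrence is run downwards from
    there.

    Finally, mu charges only {0, ..., N}: an L2 class is determined by the
    vector of values of a representative at these nodes, the inner product is
    a finite sum, and U, its inverse, the isometry and the intertwining
    relation become matrix identities in P and the diagonal matrix of masses.
    The spectrum is read off H4 = P diag(h) P^-1. *)

(** * Pochhammer symbols and Chu-Vandermonde sums *)

Section Pochhammer.
Variable R : comPzRingType.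
Implicit Types (a c : R) (n k : nat).

Lemma poch0 a : poch a 0 = 1. Proof. by rewrite /poch big_ord0. Qed.

Lemma pochS a n : poch a n.+1 = poch a n * (a + n%:R).
Proof. by rewrite /poch big_ord_recr. Qed.

Lemma pochD a m n : poch a (m + n) = poch a m * poch (a + m%:R) n.
Proof.
elim: n => [|n IH]; first by rewrite addn0 poch0 mulr1.
by rewrite addnS !pochS IH natrD addrA mulrA.
Qed.

Lemma pochSl a n : poch a n.+1 = a * poch (a + 1) n.
Proof. by rewrite -add1n pochD pochS poch0 mul1r addr0. Qed.

Lemma poch_shift a n : a * poch (1 + a) n = poch a n * (a + n%:R).
Proof. by rewrite -pochS pochSl [a + 1]addrC. Qed.

Lemma poch_fact n : poch (1 : R) n = n`!%:R.
Proof.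
by elim: n => [|n IH]; rewrite ?poch0 // pochS IH factS natrM [RHS]mulrC -nat1r.
Qed.

Lemma poch_negnat n k : poch (- n%:R : R) k = (-1) ^+ k * ('C(n, k) * k`!)%:R.
Proof.
rewrite bin_ffact; elim: k => [|k IH]; first by rewrite poch0 ffactn0 mulr1.
rewrite pochS IH ffactnSr natrM exprS.
have [kn|nk] := leqP k n; first by rewrite natrB //; ring.
by rewrite ffact_small // !(mul0r, mulr0).
Qed.

Lemma natr_bin_left m j :
  j.+1%:R * 'C(m, j.+1)%:R = (m%:R - j%:R) * 'C(m, j)%:R :> R.
Proof.
have [jm|mj] := leqP j m; last by rewrite !bin_small ?mulr0 // leqW.
by rewrite -natrB // -!natrM mul_bin_left.
Qed.

(** Pascal's rule in the form used by inductions on the upper index of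
    binomial sums. *)
Lemma sum_pascal n (F : nat -> R) :
  \sum_(k < n.+2) 'C(n.+1, k)%:R * F k =
  \sum_(k < n.+1) 'C(n, k)%:R * (F k + F k.+1).
Proof.
rewrite big_ord_recl /= bin0.
under eq_bigr do rewrite /bump /= add1n binS natrD mulrDl.
rewrite big_split /= addrA.
under [RHS]eq_bigr do rewrite mulrDr.
rewrite big_split /=; congr (_ + _).
rewrite [RHS]big_ord_recl /= bin0; congr (_ + _).
by rewrite big_ord_recr /= bin_small // mul0r addr0.
Qed.

(** By [sum_pascal], passing from n to n + 1 multiplies the summand of index k
    by (c + n - k) + (a + k), which does not depend on k. *)
Lemma poch_vandermonde n a c :
  \sum_(k < n.+1) 'C(n, k)%:R * (poch a k * poch c (n - k)%N) = poch (a + c) n.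
Proof.
elim: n => [|n IH]; first by rewrite big_ord1 !poch0 !mulr1.
rewrite (sum_pascal n (fun k => poch a k * poch c (n.+1 - k)%N)) pochS -IH.
rewrite mulr_suml; apply: eq_bigr => k _.
have kn : (k <= n)%N by rewrite -ltnS.
have en : n%:R = (n - k)%:R + k%:R :> R by rewrite -natrD subnK.
by rewrite subSS subSn // !pochS en; ring.
Qed.

(** The terminating 2F1(-n, a; c; 1) with denominators cleared.  By
    [sum_pascal], passing from (n, c + 1) to (n + 1, c) multiplies the summand
    of index k by (c + k) - (a + k) = c - a. *)
Lemma poch_vandermonde_alt n a c :
  \sum_(k < n.+1) 'C(n, k)%:R *
     ((-1) ^+ k * poch a k * poch (c + k%:R) (n - k)%N) = poch (c - a) n.
Proof.
elim: n c => [|n IH] c; first by rewrite big_ord1 !poch0 !mulr1.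
rewrite (sum_pascal n
  (fun k => (-1) ^+ k * poch a k * poch (c + k%:R) (n.+1 - k)%N)).
rewrite pochSl -addrAC -IH mulr_sumr; apply: eq_bigr => k _.
have kn : (k <= n)%N by rewrite -ltnS.
have -> : c + 1 + k%:R = c + k.+1%:R by rewrite -nat1r addrA.
rewrite subSS subSn // pochSl pochS exprS -addrA natr1 -[k.+1%:R]natr1.
ring.
Qed.

(** Because C(N,m) C(m,j) = C(N,j) C(N-j,m-j), a second binomial factor only
    shifts the summation index. *)
Lemma sum_binbin N j (F : nat -> R) : (j <= N)%N ->
  \sum_(m < N.+1) 'C(N, m)%:R * 'C(m, j)%:R * F m =
  'C(N, j)%:R * \sum_(i < (N - j).+1) 'C(N - j, i)%:R * F (j + i)%N.
Proof.
move=> jN.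
rewrite -(big_mkord xpredT (fun m => 'C(N, m)%:R * 'C(m, j)%:R * F m)).
rewrite (big_cat_nat (n := j)) //=; last by rewrite leqW.
rewrite big1_seq ?add0r; last first.
  move=> m /=; rewrite mem_index_iota => /andP[_ mj].
  by rewrite (bin_small mj) mulr0 mul0r.
rewrite -{1}(add0n j) big_addn subSn // big_mkord mulr_sumr.
apply: eq_bigr => i _; rewrite (addnC i j) mulrA -!natrM.
congr (_%:R * _).
have iN : (j + i <= N)%N by move: (ltn_ord i); lia.
have P : (0 < (j`! * i`! * (N - (j + i))`!))%N by rewrite !muln_gt0 !fact_gt0.
apply/eqP; rewrite -(eqn_pmul2r P); apply/eqP.
have E1 := bin_fact iN; have E2 := bin_fact (leq_addr i j).
have iNj : (i <= N - j)%N by lia.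
have E3 := bin_fact jN; have E4 := bin_fact iNj.
rewrite -subnDA in E4; rewrite addKn in E2.
transitivity N`!; first by rewrite -E1 -E2; ring.
by rewrite -E3 -E4; ring.
Qed.

(** Binomial coefficients vanish above the diagonal; a summation range common
    to all terms lets double sums be exchanged. *)
Lemma sum_bin_widen N j (F : nat -> R) : (j <= N)%N ->
  \sum_(k < j.+1) 'C(j, k)%:R * F k = \sum_(k < N.+1) 'C(j, k)%:R * F k.
Proof.
move=> jN; rewrite (big_ord_widen N.+1 (fun k => 'C(j, k)%:R * F k)) //.
rewrite big_mkcond; apply: eq_bigr => k _; case: ifPn => //.
by rewrite -leqNgt => jk; rewrite bin_small // mul0r.
Qed.

(** After the shift j = k + i, the factor (e+j)_(N-j) splits at x: the part
    (e+x)_(N-x) is constant and the rest is summed by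
    [poch_vandermonde_alt]. *)
Lemma sum_binbin_poch N x k u e : (x <= N)%N -> (k <= N)%N ->
  \sum_(j < N.+1) 'C(x, j)%:R * 'C(j, k)%:R *
     ((-1) ^+ j * poch u j * poch (e + j%:R) (N - j)%N) =
  'C(x, k)%:R * ((-1) ^+ k * poch u k) *
  (poch (e - u) (x - k)%N * poch (e + x%:R) (N - x)%N) :> R.
Proof.
move=> xN kN.
pose F j := (-1) ^+ j * poch u j * poch (e + j%:R) (N - j)%N.
transitivity (\sum_(j < x.+1) 'C(x, j)%:R * 'C(j, k)%:R * F j).
  under [RHS]eq_bigr do rewrite -mulrA.
  rewrite (sum_bin_widen (fun j => 'C(j, k)%:R * F j) xN).
  by apply: eq_bigr => j _; rewrite -[LHS]mulrA.
have [kx|xk] := leqP k x; last first.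
  rewrite (bin_small xk) !mul0r big1 // => j _.
  have jk : (j < k)%N by rewrite (leq_ltn_trans _ xk) // -ltnS.
  by rewrite (bin_small jk) mulr0 mul0r.
rewrite sum_binbin // -mulrA; congr (_ * _).
have -> : e - u = (e + k%:R) - (u + k%:R) by ring.
rewrite -poch_vandermonde_alt mulr_suml mulr_sumr.
apply: eq_bigr => i _; rewrite /F.
have ix : (i <= x - k)%N by rewrite -ltnS.
have -> : (N - (k + i) = (x - k - i) + (N - x))%N by lia.
rewrite !pochD exprD.
have -> : e + (k + i)%:R + (x - k - i)%:R = e + x%:R.
  by rewrite -addrA -natrD; congr (_ + _%:R); lia.
rewrite natrD addrA; ring.
Qed.

End Pochhammer.

Section PochOrder.
Variable R : realFieldType.
Implicit Types (a : R) (n : nat).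

Lemma poch_gt0 a n : 0 < a -> 0 < poch a n.
Proof. by move=> a0; apply: prodr_gt0 => i _; rewrite ltr_wpDr. Qed.

Lemma natr_fact_neq0 n : n`!%:R != 0 :> R.
Proof. by rewrite pnatr_eq0 -lt0n fact_gt0. Qed.

Lemma natr_bin_neq0 n k : (k <= n)%N -> 'C(n, k)%:R != 0 :> R.
Proof. by move=> kn; rewrite pnatr_eq0 -lt0n bin_gt0. Qed.

Lemma poch_nat_fact m k : poch (m%:R + 1 : R) k = (m + k)`!%:R / m`!%:R.
Proof.
apply: (canRL (mulfK (natr_fact_neq0 m))).
by rewrite mulrC -!poch_fact pochD addrC.
Qed.

Lemma gbinom_poch a j : gbinom (a + j%:R) j = poch (a + 1) j / j`!%:R.
Proof.
rewrite /gbinom; congr (_ / _); rewrite /poch (reindex_inj rev_ord_inj) /=.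
apply: eq_bigr => i _; rewrite natrB // -[i.+1%:R]natr1; ring.
Qed.

Lemma gbinomS a j : gbinom a j.+1 = gbinom a j * ((a - j%:R) / j.+1%:R).
Proof.
by rewrite /gbinom big_ord_recr /= factS natrM invfM; ring.
Qed.

End PochOrder.

(** * The dual Hahn polynomials are eigenvectors *)

Section DualHahnSpectral.
Variables (R : realType) (N : nat) (gamma delta : R).
Hypotheses (gamma_gt : -1 < gamma) (delta_gt : -1 < delta).

Let g_gt0 : 0 < gamma + 1. Proof. by move: gamma_gt; lra. Qed.
Let d_gt0 : 0 < delta + 1. Proof. by move: delta_gt; lra. Qed.

(** At a natural number x, (-n)_j (-x)_j / ((-N)_j j!) is
    (-1)^j C(n,j) C(x,j) / C(N,j); in this form the summation range does not
    depend on n. *)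
Lemma dual_hahn_natE (n x : nat) : (n <= N)%N ->
  dual_hahn N gamma delta n x%:R =
  \sum_(j < N.+1) 'C(n, j)%:R * ('C(x, j)%:R * ((-1) ^+ j *
     poch (x%:R + gamma + delta + 1) j) /
     ('C(N, j)%:R * poch (gamma + 1) j)).
Proof.
move=> nN; rewrite /dual_hahn.
rewrite -(sum_bin_widen (fun j => 'C(x, j)%:R * ((-1) ^+ j *
     poch (x%:R + gamma + delta + 1) j) /
     ('C(N, j)%:R * poch (gamma + 1) j)) nN).
apply: eq_bigr => j _.
have jN : (j <= N)%N by rewrite (leq_trans _ nN) // -ltnS.
rewrite !poch_negnat !natrM.
have c0 := natr_bin_neq0 R jN; have f0 := natr_fact_neq0 R j.
have g0 := gt_eqF (poch_gt0 j g_gt0).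
have s0 : (-1) ^+ j != 0 :> R by rewrite signr_eq0.
by field; rewrite s0 c0 f0 g0.
Qed.

(** Set a = gamma + 1 + n, b = delta + 1 + N - n, u = x + s and
    c = gamma + 1.  [poch_vandermonde] sums over m and leaves a sum over j
    with the quotient (a)_j / (c)_j.  Since a - c = n is an integer,
    [poch_vandermonde_alt] expands this quotient in the C(j,k) C(n,k), and
    [sum_binbin_poch] then sums over j.  The remaining sum over k is the
    polynomial on the right, because a + b - u = N - x + 1. *)
Lemma dual_hahn_eigen (n x : nat) : (n <= N)%N -> (x <= N)%N ->
  \sum_(m < N.+1) 'C(N, m)%:R *
     (poch (gamma + 1 + n%:R) m * poch (delta + 1 + (N - n)%:R) (N - m)%N) *
     dual_hahn N gamma delta m x%:R =
  N`!%:R * gbinom (2 * N%:R + gamma + delta + 1) (N - x)%N *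
  dual_hahn N gamma delta n x%:R.
Proof.
move=> nN xN.
set a := gamma + 1 + n%:R; set b := delta + 1 + (N - n)%:R.
set u := x%:R + gamma + delta + 1.
set c := gamma + 1.
have c0 j : poch c j != 0 by rewrite gt_eqF // poch_gt0.
transitivity (\sum_(j < N.+1) 'C(x, j)%:R * ((-1) ^+ j * poch u j *
    poch (a + b + j%:R) (N - j)%N) * (poch a j / poch c j)).
  transitivity (\sum_(m < N.+1) \sum_(j < N.+1) 'C(N, m)%:R * 'C(m, j)%:R *
     (poch a m * poch b (N - m)%N) * ('C(x, j)%:R * ((-1) ^+ j *
     poch u j) / ('C(N, j)%:R * poch c j))).
    apply: eq_bigr => m _; rewrite dual_hahn_natE -1?ltnS // mulr_sumr.
    by apply: eq_bigr => j _; rewrite -/u -/c; ring.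
  rewrite exchange_big; apply: eq_bigr => j _ /=; rewrite -mulr_suml.
  have jN : (j <= N)%N by rewrite -ltnS.
  rewrite (sum_binbin (fun m => poch a m * poch b (N - m)%N)) //.
  have -> : \sum_(i < (N - j).+1) 'C(N - j, i)%:R *
      (poch a (j + i) * poch b (N - (j + i))%N) =
      poch a j * poch (a + b + j%:R) (N - j)%N.
    have -> : a + b + j%:R = (a + j%:R) + b by ring.
    rewrite -(poch_vandermonde _ (a + j%:R) b) mulr_sumr.
    by apply: eq_bigr => i _; rewrite pochD subnDA; ring.
  have := natr_bin_neq0 R jN; have := c0 j.
  by move=> h1 h2; field; rewrite h1 h2.
have quot j : (j <= N)%N -> poch a j / poch c j =
    \sum_(k < N.+1) 'C(j, k)%:R * (('C(n, k) * k`!)%:R / poch c k).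
  move=> jN; rewrite -(sum_bin_widen
    (fun k => ('C(n, k) * k`!)%:R / poch c k) jN).
  have -> : a = c - - n%:R by rewrite opprK.
  rewrite -(poch_vandermonde_alt _ (- n%:R) c) mulr_suml; apply: eq_bigr => k _.
  have kj : (k <= j)%N by rewrite -ltnS.
  rewrite poch_negnat -[in poch c j](subnKC kj) pochD.
  have s1 : (-1) ^+ k * (-1) ^+ k = 1 :> R by rewrite -expr2 sqrr_sign.
  have c1 : poch (c + k%:R) (j - k)%N != 0.
    by rewrite gt_eqF // poch_gt0 // ltr_wpDr.
  rewrite [(-1) ^+ k * _]mulrA s1 mul1r.
  have := c0 k => h; by field; rewrite h c1.
transitivity (\sum_(k < N.+1) ('C(n, k) * k`!)%:R / poch c k *
    ('C(x, k)%:R * ((-1) ^+ k * poch u k) *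
     (poch (a + b - u) (x - k)%N * poch (a + b + x%:R) (N - x)%N))).
  transitivity (\sum_(j < N.+1) \sum_(k < N.+1) ('C(n, k) * k`!)%:R / poch c k *
     ('C(x, j)%:R * 'C(j, k)%:R * ((-1) ^+ j * poch u j *
       poch (a + b + j%:R) (N - j)%N))).
    apply: eq_bigr => j _; rewrite quot -1?ltnS // mulr_sumr.
    by apply: eq_bigr => k _; ring.
  rewrite exchange_big; apply: eq_bigr => k _ /=.
  by rewrite -mulr_sumr sum_binbin_poch // -ltnS.
rewrite dual_hahn_natE // mulr_sumr; apply: eq_bigr => k _; rewrite -/u -/c.
have kN : (k <= N)%N by rewrite -ltnS.
have [kx|xk] := leqP k x; last by rewrite (bin_small xk) !(mul0r, mulr0).
have -> : 2 * N%:R + gamma + delta + 1 =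
    (a + b + x%:R - 1) + (N - x)%:R.
  by rewrite /a /b !natrB //; ring.
rewrite gbinom_poch subrK.
have -> : a + b - u = (N - x)%:R + 1 by rewrite /a /b /u !natrB //; ring.
rewrite poch_nat_fact.
have -> : (N - x + (x - k) = N - k)%N by lia.
rewrite -(bin_fact kN) !natrM.
have h1 := natr_fact_neq0 R (N - x); have h2 := c0 k.
have h3 := natr_bin_neq0 R kN.
by field; rewrite h1 h2 h3.
Qed.

(** * The moments of the weight *)

(** With s = gamma + delta + 1, the weight at x is the product of this quantity
    and (2x + s) / (x + s).  The second factor is 0 / 0 at x = 0 when s = 0
    and equals 1 at x = 0 otherwise; the denominators here never vanish, so
    the degenerate case needs attention only in [weight0E]. *)
Definition reg_weight (x : nat) : R :=
  poch (1 + gamma) x / (poch (1 + (x%:R + gamma + delta + 1)) N *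
    (poch (1 + delta) x * (N - x)%N`!%:R * x`!%:R)).

Let regular_den x : poch (1 + (x%:R + gamma + delta + 1)) N != 0.
Proof.
rewrite gt_eqF // poch_gt0 //.
have : 0 <= x%:R :> R by [].
by move: gamma_gt delta_gt; lra.
Qed.

Let delta_den x : poch (1 + delta) x != 0.
Proof. by rewrite gt_eqF // poch_gt0 // addrC. Qed.

Let shiftS_neq0 x : x.+1%:R + gamma + delta + 1 != 0.
Proof.
have : 0 <= x%:R :> R by [].
by rewrite -natr1 => x0; apply: lt0r_neq0; move: gamma_gt delta_gt; lra.
Qed.

Lemma weight0E : weight N gamma delta 0 = reg_weight 0.
Proof.
rewrite /weight /reg_weight /weight_quot !poch0 eqxx /=.
have h1 := regular_den 0; rewrite add0r in h1.
have h2 := natr_fact_neq0 R (N - 0); have h3 := natr_fact_neq0 R 0.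
have e2 : 2 + gamma + delta = 1 + (gamma + delta + 1) by ring.
case: ifPn => [_|s0].
  rewrite add0r e2.
  by field; rewrite h1 h2 h3.
have e : 1 + 0 + gamma + delta = gamma + delta + 1 by ring.
rewrite !mulr0n e pochSl !add0r [_ + 1 + 1]addrC mulr0 add0r.
by field; rewrite h1 h2 h3 s0.
Qed.

Lemma weightSE x : weight N gamma delta x.+1 =
  reg_weight x.+1 * (2 * x.+1%:R + gamma + delta + 1) /
  (x.+1%:R + gamma + delta + 1).
Proof.
rewrite /weight /reg_weight /weight_quot /=.
have h1 := regular_den x.+1.
have h2 := natr_fact_neq0 R (N - x.+1); have h3 := natr_fact_neq0 R x.+1.
have h4 := delta_den x.+1.
have h5 := shiftS_neq0 x.
have e : 1 + x.+1%:R + gamma + delta = x.+1%:R + gamma + delta + 1 by ring.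
rewrite pochSl e [_ + 1 + 1]addrC.
set u := x.+1%:R + gamma + delta + 1 in h1 h5 *.
by field; rewrite h1 h2 h3 h4 h5.
Qed.

(** The discrete Pearson equation of the weight. *)
Lemma reg_weightS x : (x < N)%N ->
  reg_weight x * ((1 + gamma + x%:R) * (N%:R - x%:R)) *
    (x.+1%:R + gamma + delta + 1) =
  reg_weight x.+1 * ((x.+1%:R + gamma + delta + 1 + N%:R) *
    (delta + x.+1%:R) * x.+1%:R).
Proof.
move=> xN; rewrite /reg_weight.
set u := x.+1%:R + gamma + delta + 1.
have eu : 1 + (x%:R + gamma + delta + 1) = u by rewrite /u -natr1; ring.
have eNx : N%:R - x%:R = (N - x)%:R :> R by rewrite natrB // ltnW.
have h1 := regular_den x; rewrite eu in h1.
have h1' := regular_den x.+1; rewrite -/u in h1'.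
have h2 := natr_fact_neq0 R (N - x.+1); have h3 := natr_fact_neq0 R x.
have h4 := delta_den x.
have h5 : 1 + delta + x%:R != 0.
  have : 0 <= x%:R :> R by [].
  by move=> x0; apply: lt0r_neq0; move: gamma_gt delta_gt; lra.
have h6 : 1 + x%:R != 0 :> R by rewrite nat1r pnatr_eq0.
have h7 : (N - x)%:R != 0 :> R by rewrite pnatr_eq0 -lt0n subn_gt0.
rewrite eu eNx !pochS.
have -> : ((N - x)`! = (N - x) * (N - x.+1)`!)%N.
  by rewrite subnS; case: (N - x)%N (subn_gt0 x N) => [|m _]; rewrite ?xN.
have -> : (x.+1`! = x.+1 * x`!)%N by rewrite factS.
have -> : delta + x.+1%:R = 1 + delta + x%:R by rewrite -natr1; ring.
rewrite !natrM.
apply: (mulIf h1); apply: (mulIf h1').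
transitivity (poch (1 + gamma) x * (1 + gamma + x%:R) * (u * poch (1 + u) N) /
   (poch (1 + delta) x * (N - x.+1)`!%:R * x`!%:R)).
  by field; rewrite h1 h2 h3 h4 h7.
rewrite poch_shift.
by field; rewrite h1' h2 h3 h4 h5 h6.
Qed.

Definition moment (j : nat) : R := \sum_(x < N.+1) weight N gamma delta x *
  ('C(x, j)%:R * poch (x%:R + gamma + delta + 1) j).

(** The bracket is chosen so that summing it against the weight relates the
    moments j and j + 1.  The right-hand side is the discrete antiderivative;
    its factor N - X makes the whole sum vanish.  The induction step uses
    [reg_weightS] and the cubic identity
      (u+N)(delta+X)(X-j) + (2X+s)((j-X)(u+j) + (gamma+1+j)(N-j))
        = (u+j)(gamma+1+X)(N-X),  where u = X + s. *)
Lemma gosper_partial_sum j X : (X <= N)%N ->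
  \sum_(x < X.+1) weight N gamma delta x *
    ('C(x, j)%:R * poch (x%:R + gamma + delta + 1) j) *
    ((j%:R - x%:R) * (x%:R + gamma + delta + 1 + j%:R) +
     (gamma + 1 + j%:R) * (N%:R - j%:R)) =
  reg_weight X * ('C(X, j)%:R * poch (1 + (X%:R + gamma + delta + 1)) j) *
    ((1 + gamma + X%:R) * (N%:R - X%:R)).
Proof.
elim: X => [_|X IH XN].
  rewrite big_ord1 weight0E /=.
  by case: j => [|j]; rewrite ?bin0n /= ?poch0; ring.
rewrite big_ord_recr IH ?(ltnW XN) //= weightSE.
have rec := reg_weightS XN.
set u := X.+1%:R + gamma + delta + 1 in rec *.
have eu : 1 + (X%:R + gamma + delta + 1) = u by rewrite /u -natr1; ring.
have u0 : u != 0 := shiftS_neq0 X.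
have ebin : X.+1%:R * 'C(X, j)%:R = (X.+1%:R - j%:R) * 'C(X.+1, j)%:R :> R.
  have [jX|] := leqP j X.+1.
    by rewrite -natrB // -!natrM mul_bin_down.
  by move=> Xj; rewrite !bin_small ?(ltnW Xj) // !mulr0.
rewrite eu; apply: (mulIf u0).
rewrite mulrDl.
have -> : reg_weight X * ('C(X, j)%:R * poch u j) *
     ((1 + gamma + X%:R) * (N%:R - X%:R)) * u =
     reg_weight X.+1 * ((u + N%:R) * (delta + X.+1%:R)) * poch u j *
     (X.+1%:R * 'C(X, j)%:R).
  transitivity (reg_weight X * ((1 + gamma + X%:R) * (N%:R - X%:R)) * u *
    ('C(X, j)%:R * poch u j)); first by ring.
  by rewrite rec; ring.
rewrite ebin.
have -> : reg_weight X.+1 * ('C(X.+1, j)%:R * poch (1 + u) j) *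
     ((1 + gamma + X.+1%:R) * (N%:R - X.+1%:R)) * u =
  reg_weight X.+1 * 'C(X.+1, j)%:R *
     ((1 + gamma + X.+1%:R) * (N%:R - X.+1%:R)) * (u * poch (1 + u) j) by ring.
rewrite poch_shift.
have -> : X.+1%:R = u - gamma - delta - 1 by rewrite /u; ring.
by field.
Qed.

Lemma momentS j : (j < N)%N ->
  j.+1%:R * moment j.+1 = (gamma + 1 + j%:R) * (N%:R - j%:R) * moment j.
Proof.
move=> jN; apply/eqP; rewrite eq_sym -subr_eq0; apply/eqP.
rewrite /moment !mulr_sumr -sumrB.
have telescoped := gosper_partial_sum j (leqnn N).
rewrite subrr !mulr0 in telescoped; rewrite -[RHS]telescoped.
apply: eq_bigr => x _; rewrite pochS.
transitivity ((gamma + 1 + j%:R) * (N%:R - j%:R) * (weight N gamma delta x *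
   ('C(x, j)%:R * poch (x%:R + gamma + delta + 1) j)) -
   (j.+1%:R * 'C(x, j.+1)%:R) * (weight N gamma delta x *
   (poch (x%:R + gamma + delta + 1) j * (x%:R + gamma + delta + 1 + j%:R)))).
  by ring.
by rewrite natr_bin_left; ring.
Qed.

(** C(x,N) = 0 for x < N, so only the node x = N contributes. *)
Lemma moment_top :
  N`!%:R * poch (1 + delta) N * moment N = poch (gamma + 1) N.
Proof.
have d0 := delta_den N; have f0 := natr_fact_neq0 R N.
rewrite /moment big_ord_recr /= big1 ?add0r; last first.
  by move=> x _; rewrite bin_small // mul0r mulr0.
rewrite binn mul1r.
have : weight N gamma delta N * poch (N%:R + gamma + delta + 1) N =
    poch (1 + gamma) N / (poch (1 + delta) N * N`!%:R).
  have := weight0E; have := weightSE N.-1; have h1 := regular_den N.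
  rewrite /reg_weight; case: N h1 d0 f0 => [|M] h1 d0 f0 /= W W0.
    by rewrite W0 subn0 !poch0 /= fact0; field.
  rewrite W subnn fact0.
  set u := M.+1%:R + gamma + delta + 1 in h1 *.
  have u0 : u != 0 := shiftS_neq0 M.
  have -> : 2 * M.+1%:R + gamma + delta + 1 = u + M.+1%:R by rewrite /u; ring.
  transitivity (poch (1 + gamma) M.+1 * (poch u M.+1 * (u + M.+1%:R)) /
     (u * poch (1 + u) M.+1) / (poch (1 + delta) M.+1 * M.+1`!%:R)).
    by field; rewrite h1 d0 f0 u0.
  by rewrite -poch_shift; field; rewrite h1 d0 f0 u0.
move=> ->; rewrite [gamma + 1]addrC.
by field; rewrite d0 f0.
Qed.

(** Descending induction from [moment_top]: in [momentS] the factor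
    (gamma+1+j)(N-j) is nonzero for j < N. *)
Lemma momentE j : (j <= N)%N ->
  N`!%:R * poch (1 + delta) N * moment j = 'C(N, j)%:R * poch (gamma + 1) j.
Proof.
move=> jN; rewrite -(subKn jN).
elim: (N - j)%N (leq_subr j N) => {j jN} [|i IH] iN.
  by rewrite subn0 binn mul1r moment_top.
have {}IH := IH (ltnW iN).
set j := (N - i.+1)%N; have ej : (N - i = j.+1)%N by rewrite /j; lia.
have jN : (j < N)%N by rewrite /j; lia.
rewrite ej in IH.
have h : (gamma + 1 + j%:R) * (N%:R - j%:R) != 0.
  rewrite mulf_neq0 //; first by rewrite gt_eqF // ltr_wpDr.
  by rewrite -natrB ?(ltnW jN) // pnatr_eq0 -lt0n subn_gt0.
apply: (mulfI h).
rewrite mulrCA -momentS // mulrCA IH pochS.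
by rewrite mulrA natr_bin_left; ring.
Qed.

Lemma dual_hahn_mean n : (n <= N)%N ->
  \sum_(x < N.+1) poch (1 + delta) N * N`!%:R * weight N gamma delta x *
     dual_hahn N gamma delta n x%:R = (n == 0%N)%:R.
Proof.
move=> nN.
transitivity (\sum_(j < N.+1) 'C(n, j)%:R * (-1) ^+ j : R).
  under eq_bigr do rewrite dual_hahn_natE // mulr_sumr.
  rewrite exchange_big; apply: eq_bigr => j _ /=.
  have jN : (j <= N)%N by rewrite -ltnS.
  have h1 := natr_bin_neq0 R jN; have h2 := gt_eqF (poch_gt0 j g_gt0).
  transitivity (N`!%:R * poch (1 + delta) N * moment j *
     ('C(n, j)%:R * (-1) ^+ j / ('C(N, j)%:R * poch (gamma + 1) j))).
    by rewrite /moment !(mulr_sumr, mulr_suml); apply: eq_bigr => x _; ring.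
  by rewrite momentE //; field; rewrite h1 h2.
rewrite -(sum_bin_widen (fun j => (-1) ^+ j) nN).
have := exprDn (1 : R) (-1) n; rewrite subrr expr0n => ->.
by apply: eq_bigr => j _; rewrite expr1n mul1r -[RHS]mulr_natl.
Qed.

(** * Orthogonality from distinct eigenvalues *)

Definition mass (x : nat) : R :=
  poch (1 + delta) N * N`!%:R * weight N gamma delta x.

Definition eigval (x : nat) : R :=
  gbinom (2 * N%:R + gamma + delta + 1) (N - x)%N.

(* s = gamma + delta + 1 > -1 *)
Let eigval_param_gt : 2 * N%:R - 1 < 2 * N%:R + gamma + delta + 1.
Proof. by move: gamma_gt delta_gt; lra. Qed.

Lemma gbinom_gt0 j : (j <= N)%N ->
  0 < gbinom (2 * N%:R + gamma + delta + 1) j.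
Proof.
move=> jN; rewrite divr_gt0 ?ltr0n ?fact_gt0 //; apply: prodr_gt0 => i _.
have : i.+1%:R <= N%:R :> R by rewrite ler_nat (leq_trans (ltn_ord i)).
have : 0 <= i%:R :> R by [].
by rewrite -natr1; move: eigval_param_gt; lra.
Qed.

(** The ratio (2N + s - j) / (j + 1) of consecutive coefficients exceeds 1 for
    j < N because s > -1. *)
Lemma gbinom_ltS j : (j < N)%N ->
  gbinom (2 * N%:R + gamma + delta + 1) j <
  gbinom (2 * N%:R + gamma + delta + 1) j.+1.
Proof.
move=> jN; rewrite gbinomS ltr_pMr ?gbinom_gt0 ?(ltnW jN) //.
rewrite ltr_pdivlMr ?ltr0n // mul1r.
have : j.+1%:R <= N%:R :> R by rewrite ler_nat.
by rewrite -natr1; move: eigval_param_gt; lra.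
Qed.

Lemma gbinom_lt i j : (i < j)%N -> (j <= N)%N ->
  gbinom (2 * N%:R + gamma + delta + 1) i <
  gbinom (2 * N%:R + gamma + delta + 1) j.
Proof.
elim: j => // j IH; rewrite ltnS leq_eqVlt => /orP[/eqP -> | ij] jN.
  exact: gbinom_ltS.
exact: lt_trans (IH ij (ltnW jN)) (gbinom_ltS jN).
Qed.

Lemma eigval_inj (x y : 'I_N.+1) : eigval x = eigval y -> x = y.
Proof.
move=> e; apply/val_inj => /=.
have xN : (x <= N)%N by rewrite -ltnS.
have yN : (y <= N)%N by rewrite -ltnS.
have lt_neq i j : (i < j)%N -> (j <= N)%N -> eigval i != eigval j.
  move=> ij jN; rewrite gt_eqF // gbinom_lt ?leq_subr //.
  by rewrite ltn_sub2l // (leq_trans ij).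
have [xy|yx|//] := ltngtP x y.
  by have := lt_neq _ _ xy yN; rewrite e eqxx.
by have := lt_neq _ _ yx xN; rewrite e eqxx.
Qed.

Definition H4_real : 'M[R]_N.+1 := \matrix_(m, n)
  (poch (1 + gamma) (m + n)%N * poch (1 + delta) (2 * N - m - n)%N /
   Num.sqrt (m`!%:R * n`!%:R * (N - m)%N`!%:R * (N - n)%N`!%:R *
     poch (1 + gamma) m * poch (1 + gamma) n *
     poch (1 + delta) (N - m)%N * poch (1 + delta) (N - n)%N)).

Definition Phat_mx : 'M[R]_N.+1 :=
  \matrix_(n, x) Phat_fun N gamma delta n (x : nat)%:R.

Definition eigval_row : 'rV[R]_N.+1 := \row_x eigval x.
Definition mass_row : 'rV[R]_N.+1 := \row_x mass x.

Let pg n : 0 < poch (1 + gamma) n.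
Proof. by rewrite poch_gt0 // addrC. Qed.
Let pd n : 0 < poch (1 + delta) n.
Proof. by rewrite poch_gt0 // addrC. Qed.
Let pf n : 0 < n`!%:R :> R.
Proof. by rewrite ltr0n fact_gt0. Qed.

(** The square root in the entry (m, n) of H4 factors as
    sqrt (row_scale m) * sqrt (row_scale n). *)
Definition row_scale (n : nat) : R :=
  n`!%:R * (N - n)%N`!%:R * poch (1 + gamma) n * poch (1 + delta) (N - n)%N.

Lemma row_scale_gt0 n : 0 < row_scale n.
Proof. by rewrite !mulr_gt0. Qed.

Lemma Phat_fun_scale n x : Phat_fun N gamma delta n x =
  Num.sqrt (N`!%:R / poch (1 + delta) N) * Num.sqrt (row_scale n) /
  (n`!%:R * (N - n)%N`!%:R) * dual_hahn N gamma delta n x.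
Proof.
set F := n`!%:R * (N - n)`!%:R.
have F0 : 0 < F by rewrite mulr_gt0.
have dN0 := pd N; have W0 := row_scale_gt0 n.
rewrite /Phat_fun -/F; congr (_ * _).
have -> : N`!%:R * poch (1 + gamma) n * poch (1 + delta) (N - n)%N /
    (F * poch (1 + delta) N) =
    N`!%:R / poch (1 + delta) N * row_scale n * F^-1 ^+ 2.
  by rewrite /row_scale -/F; field; rewrite !gt_eqF.
have q0 : 0 <= N`!%:R / poch (1 + delta) N by rewrite ltW // divr_gt0.
rewrite (sqrtrM _ (mulr_ge0 q0 (ltW W0))) (sqrtrM _ q0) sqrtr_sqr.
by rewrite ger0_norm // invr_ge0 ltW.
Qed.

Lemma H4_real_eigen : H4_real *m Phat_mx = Phat_mx *m diag_mx eigval_row.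
Proof.
apply/matrixP => n x; rewrite mul_mx_diag !mxE.
have nN : (n <= N)%N by rewrite -ltnS.
have xN : (x <= N)%N by rewrite -ltnS.
set kap := Num.sqrt (N`!%:R / poch (1 + delta) N).
have sW m : Num.sqrt (row_scale m) != 0.
  by rewrite gt_eqF // sqrtr_gt0 row_scale_gt0.
transitivity (kap / Num.sqrt (row_scale n) * poch (1 + gamma) n *
   poch (1 + delta) (N - n)%N / N`!%:R *
   (N`!%:R * eigval x * dual_hahn N gamma delta n x%:R)).
  rewrite -dual_hahn_eigen // mulr_sumr; apply: eq_bigr => m _.
  have mN : (m <= N)%N by rewrite -ltnS.
  rewrite !mxE Phat_fun_scale -/kap.
  have -> : n`!%:R * m`!%:R * (N - n)`!%:R * (N - m)`!%:R *
     poch (1 + gamma) n * poch (1 + gamma) m * poch (1 + delta) (N - n) *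
     poch (1 + delta) (N - m) = row_scale n * row_scale m.
    by rewrite /row_scale; ring.
  rewrite sqrtrM ?(ltW (row_scale_gt0 _)) //.
  rewrite pochD; have -> : (2 * N - n - m = (N - n) + (N - m))%N by lia.
  rewrite pochD [1 + gamma]addrC [1 + delta]addrC -(bin_fact mN) !natrM.
  have h1 := sW n; have h2 := sW m; have h3 := natr_fact_neq0 R m.
  have h4 := natr_fact_neq0 R (N - m); have h5 := natr_bin_neq0 R mN.
  by field; rewrite h1 h2 h3 h4 h5.
rewrite Phat_fun_scale -/kap.
have h3 := natr_fact_neq0 R n; have h4 := natr_fact_neq0 R (N - n).
have h1 := sW n; have h5 := natr_fact_neq0 R N.
rewrite -[kap / _ * _ * _]mulrA.
have -> : poch (1 + gamma) n * poch (1 + delta) (N - n) =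
    Num.sqrt (row_scale n) ^+ 2 / (n`!%:R * (N - n)`!%:R).
  rewrite sqr_sqrtr ?(ltW (row_scale_gt0 n)) // /row_scale.
  by field; rewrite h3 h4.
by field; rewrite h1 h3 h4 h5.
Qed.

Lemma dual_hahn0 x : dual_hahn N gamma delta 0 x = 1.
Proof. by rewrite /dual_hahn big_ord1 !poch0 fact0 !mulr1 divr1. Qed.

Lemma Phat_fun0 x : Phat_fun N gamma delta 0 x = 1.
Proof.
have h1 := natr_fact_neq0 R N; have h2 := pd N.
rewrite /Phat_fun dual_hahn0 mulr1 subn0 fact0 poch0 mulr1 mul1r.
by rewrite divff ?sqrtr1 // mulf_neq0 // gt_eqF.
Qed.

Lemma Phat_mean (n : 'I_N.+1) :
  \sum_(x < N.+1) Phat_mx n x * mass x = (n == 0)%:R.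
Proof.
have nN : (n <= N)%N by rewrite -ltnS.
under eq_bigr do rewrite mxE /Phat_fun mulrAC -mulrA.
rewrite -mulr_sumr.
have -> : \sum_(x < N.+1) mass x * dual_hahn N gamma delta n x%:R =
    (n == 0)%:R by exact: dual_hahn_mean.
case: eqVneq => [->|_]; last by rewrite mulr0.
by have := Phat_fun0 0; rewrite /Phat_fun dual_hahn0 => ->.
Qed.

Lemma H4_real_sym : H4_real^T = H4_real.
Proof.
apply/matrixP => m n; rewrite !mxE addnC; congr (_ * poch _ _ / Num.sqrt _).
  by lia.
by ring.
Qed.

(** As H4 is symmetric, the Gram matrix P^T P commutes with diag(h); the h(x)
    are distinct, so it is diagonal. *)
Lemma Phat_gram_diag (x y : 'I_N.+1) : x != y ->
  (Phat_mx^T *m Phat_mx) x y = 0.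
Proof.
move=> xy; set G := _ *m _.
have comm : G *m diag_mx eigval_row = diag_mx eigval_row *m G.
  rewrite /G -mulmxA -H4_real_eigen mulmxA -{1}H4_real_sym -trmx_mul.
  rewrite H4_real_eigen.
  by rewrite trmx_mul tr_diag_mx mulmxA.
have /matrixP/(_ x y) := comm; rewrite mul_mx_diag mul_diag_mx !mxE => e.
apply/eqP; apply: contraNT xy => G0; apply/eqP/eigval_inj.
by rewrite mulrC in e; move/(mulIf G0): e => ->.
Qed.

(** The inverse squared norms of the columns of P and the masses of mu solve the
    same invertible linear system, whose right-hand side is the first basis
    vector, so they coincide. *)
Lemma Phat_completeness :
  Phat_mx^T *m Phat_mx *m diag_mx mass_row = 1%:M.
Proof.
set G := Phat_mx^T *m Phat_mx.
have G0 x : G x x != 0.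
  rewrite gt_eqF // mxE; apply: lt_le_trans (ltr01) _.
  rewrite (bigD1 ord0) //= !mxE Phat_fun0 mul1r lerDl.
  by apply: sumr_ge0 => n _; rewrite !mxE -expr2 sqr_ge0.
pose ginv : 'rV[R]_N.+1 := \row_x (G x x)^-1.
have inv : G *m diag_mx ginv = 1%:M.
  rewrite mul_mx_diag; apply/matrixP => x y.
  rewrite mxE [ginv _ _]mxE [RHS]mxE.
  case: eqVneq => [->|xy]; first by rewrite divff.
  by rewrite [X in X * _](Phat_gram_diag xy) mul0r.
(* a right inverse of a square matrix is a left inverse *)
have left_inv : Phat_mx *m (diag_mx ginv *m Phat_mx^T) = 1%:M.
  by rewrite mulmxA; apply: mulmx1C; rewrite mulmxA.
suff -> : mass_row = ginv by [].
have col_inj (v w : 'cV[R]_N.+1) : Phat_mx *m v = Phat_mx *m w -> v = w.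
  move=> /(congr1 (mulmx (diag_mx ginv *m Phat_mx^T))).
  by rewrite !(mulmxA (diag_mx ginv *m _)) (mulmx1C left_inv) !mul1mx.
apply: trmx_inj; apply: col_inj; apply/matrixP => n j; rewrite !mxE.
transitivity ((n == 0)%:R : R).
  by rewrite -Phat_mean; apply: eq_bigr => x _; rewrite !mxE.
(* column 0 of this identity is the linear system for ginv: P(0, x) = 1 *)
have /matrixP/(_ n 0) := left_inv; rewrite mul_diag_mx !mxE => <-.
by apply: eq_bigr => x _; rewrite !mxE Phat_fun0 mulr1.
Qed.

Lemma Phat_orthonormality :
  Phat_mx *m (diag_mx mass_row *m Phat_mx^T) = 1%:M.
Proof.
by rewrite mulmxA; apply: mulmx1C; rewrite mulmxA Phat_completeness.
Qed.

End DualHahnSpectral.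

(** * Square-integrable functions on the nodes *)

Section MultiplicationModel.
Variables (R : realType) (N : nat) (gamma delta : R).
Hypotheses (gamma_gt : -1 < gamma) (delta_gt : -1 < delta).
Local Notation mu := (mu4 N gamma_gt delta_gt).
Local Notation node x := ((nat_of_ord x)%:R : R).

Lemma mu4_aeW (P : R -> Prop) :
  (forall x : 'I_N.+1, P (node x)) -> {ae mu, forall x, P x}.
Proof.
move=> nodesP; exists (~` [set x%:R | x in `I_N.+1]); split.
- apply: measurableC; apply: countable_measurable => //.
  exact/finite_set_countable/finite_image.
- rewrite [LHS]mu4E big1 ?mule0 // => x _.
  rewrite diracE memNset ?mule0 //= => /(_ _); apply.
  by exists x => //=.
- move=> x /= nPx [k /= kN kx]; apply: nPx.
  by rewrite -kx; exact: (nodesP (Ordinal kN)).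
Qed.

Lemma ge0_integral_mu4 (f : R -> R) : measurable_fun setT f ->
  (forall x, 0 <= f x) ->
  (\int[mu]_x (f x)%:E =
   (\sum_(x < N.+1) mass N gamma delta x * f (node x))%:E)%E.
Proof.
move=> mf f0.
have mEf : measurable_fun setT (EFin \o f) by exact/measurable_EFinP.
have Ef0 x : setT x -> (0 <= (EFin \o f) x)%E by rewrite /= lee_fin.
rewrite -[X in integral _ _ X]/(EFin \o f).
rewrite ge0_integral_mscale // ge0_integral_measure_sum //.
rewrite ge0_sume_distrr; last first.
  by move=> x _; apply: integral_ge0 => y _; rewrite /= lee_fin.
rewrite -sumEFin; apply: eq_bigr => x _.
rewrite ge0_integral_mscale // integral_dirac // diracT mul1e /=.
by rewrite -!EFinM mulrA.
Qed.

Lemma Rintegral_mu4 (f : R -> R) : measurable_fun setT f ->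
  \int[mu]_x f x = \sum_(x < N.+1) mass N gamma delta x * f (node x).
Proof.
move=> mf; rewrite /Rintegral -[X in integral _ _ X]/(EFin \o f).
rewrite integralE funerpos funerneg.
rewrite !ge0_integral_mu4 //; first last.
- exact: measurable_funrpos.
- exact: measurable_funrneg.
rewrite -EFinB /= -sumrB; apply: eq_bigr => x _.
rewrite -mulrBr; congr (_ * _).
by rewrite -[in RHS](funrposBneg f).
Qed.

Lemma sum_complex n (a b : 'I_n -> R) :
  \sum_i (a i +i* b i) = (\sum_i a i) +i* (\sum_i b i).
Proof. by elim/big_rec3: _ => // i x y z _ ->. Qed.

Lemma cintegral_mu4 (f : R -> R[i]) : Defs.measurableC f ->
  cintegral mu f = \sum_(x < N.+1) (mass N gamma delta x)%:C * f (node x).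
Proof.
move=> [mr mi]; rewrite /cintegral !Rintegral_mu4 //.
rewrite -sum_complex; apply: eq_bigr => x _.
by case: (f (node x)) => a b /=; simpc.
Qed.

Local Notation RtoC := (real_complex R).
Local Notation PC := (map_mx RtoC (Phat_mx N gamma delta)).
Local Notation MC := (diag_mx (map_mx RtoC (mass_row N gamma delta))).
Local Notation L2f := (L2fun mu).

Definition node_values (f : L2f) : 'cV[R[i]]_N.+1 := \col_x f (node x).

Lemma L2class_node_values (f g : L2f) :
  node_values f = node_values g -> L2class f = L2class g.
Proof.
move=> fg; apply/L2classP; apply: mu4_aeW => x.
by move/colP/(_ x): fg; rewrite !mxE.
Qed.

Lemma L2dot_node_values (f g : L2f) : L2dot (L2class f) (L2class g) =
  cdot (MC *m node_values f) (node_values g).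
Proof.
rewrite L2dotE cintegral_mu4; last first.
  apply: measurableCM (L2fun_measurable f) _.
  exact: measurableC_conj (L2fun_measurable g).
by apply: eq_bigr => x _; rewrite mul_diag_mx !mxE mulrA.
Qed.

(** An explicit representative of the image of u, so that [node_values] can be
    computed. *)
Definition Phat_comb (u : 'cV[R[i]]_N.+1) : L2f :=
  \sum_n u n 0 *: MkL2fun (Phat_sq_integrable N gamma_gt delta_gt n).

Lemma L2fun_sumE n (F : 'I_n -> L2f) x : (\sum_i F i) x = \sum_i F i x.
Proof.
by apply: (big_morph (fun f : L2f => f x)).
Qed.

Lemma Phat_comb_values u : node_values (Phat_comb u) = PC^T *m u.
Proof.
apply/colP => x; rewrite !mxE L2fun_sumE; apply: eq_bigr => n _.
by rewrite !mxE mulrC.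
Qed.

Definition Phat_map (u : 'cV[R[i]]_N.+1) : L2 mu := L2class (Phat_comb u).

Lemma Phat_map_linear : linear Phat_map.
Proof.
move=> a u v; rewrite /Phat_map.
have -> : a *: L2class (Phat_comb u) = L2class (a *: Phat_comb u).
  exact: L2scaleE.
rewrite -L2classD; congr L2class; rewrite /Phat_comb scaler_sumr -big_split.
by apply: eq_bigr => n _; rewrite !mxE /= scalerDl scalerA.
Qed.

HB.instance Definition _ :=
  GRing.isLinear.Build _ _ _ _ Phat_map Phat_map_linear.

(** The inverse of [Phat_map]: the Fourier coefficients with respect to the
    orthonormal family of the Phat_n. *)
Definition Phat_coef (F : L2 mu) : 'cV[R[i]]_N.+1 :=
  \col_n L2dot F (Phat N gamma_gt delta_gt n).

Lemma Phat_map_delta (n : 'I_N.+1) :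
  Phat_map (delta_mx n 0) = Phat N gamma_gt delta_gt n.
Proof.
congr L2class; rewrite /Phat_comb (bigD1 n) //= mxE !eqxx scale1r.
by rewrite big1 ?addr0 // => i /negPf ni; rewrite mxE ni scale0r.
Qed.

Lemma conj_RtoC (a : R) : (a%:C)^*%R = a%:C.
Proof. exact: conjc_real. Qed.

Lemma Phat_coefE (f : L2f) :
  Phat_coef (L2class f) = PC *m (MC *m node_values f).
Proof.
apply/colP => n; rewrite [LHS]mxE L2dot_node_values [RHS]mxE.
apply: eq_bigr => x _; rewrite mulrC; congr (_ * _).
by rewrite !mxE /= conj_RtoC.
Qed.

Lemma PC_orthonormality : PC *m (MC *m PC^T) = 1%:M.
Proof.
by rewrite map_trmx -map_diag_mx -!map_mxM Phat_orthonormality // map_mx1.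
Qed.

Lemma PC_completeness : PC^T *m (PC *m MC) = 1%:M.
Proof.
by rewrite map_trmx -map_diag_mx -!map_mxM mulmxA Phat_completeness // map_mx1.
Qed.

Lemma Phat_mapK : cancel Phat_map Phat_coef.
Proof.
move=> u; rewrite Phat_coefE Phat_comb_values.
by rewrite (mulmxA MC) mulmxA PC_orthonormality mul1mx.
Qed.

Lemma Phat_coefK : cancel Phat_coef Phat_map.
Proof.
move=> F; rewrite -[F]L2classK; apply: L2class_node_values.
rewrite Phat_comb_values Phat_coefE.
by rewrite mulmxA mulmxA -[PC^T *m _ *m _]mulmxA PC_completeness mul1mx.
Qed.

Lemma cdot_mulmx n (u v : 'cV[R[i]]_n) :
  cdot u v = (u^T *m map_mx Num.conj v) 0 0.
Proof. by rewrite mxE; apply: eq_bigr => i _; rewrite !mxE. Qed.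

Lemma Phat_map_isometry u v : L2dot (Phat_map u) (Phat_map v) = cdot u v.
Proof.
rewrite L2dot_node_values !Phat_comb_values !cdot_mulmx.
rewrite map_mxM !trmx_mul trmxK tr_diag_mx.
have -> : map_mx Num.conj PC^T = PC^T.
  by apply/matrixP => x n; rewrite !mxE /= conj_RtoC.
by rewrite -!mulmxA (mulmxA MC) (mulmxA PC) PC_orthonormality mul1mx.
Qed.

Lemma H4_map : H4 N gamma delta = map_mx RtoC (H4_real N gamma delta).
Proof. by apply/matrixP => m n; rewrite !mxE. Qed.

Lemma H4_eigen : H4 N gamma delta *m PC =
  PC *m diag_mx (map_mx RtoC (eigval_row N gamma delta)).
Proof. by rewrite H4_map -map_mxM H4_real_eigen // map_mxM map_diag_mx. Qed.

Lemma H4_sym : (H4 N gamma delta)^T = H4 N gamma delta.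
Proof. by rewrite H4_map map_trmx H4_real_sym. Qed.

Lemma Phat_map_intertwines F :
  Phat_map (H4 N gamma delta *m Phat_coef F) = L2mul (h4 N gamma delta) F.
Proof.
rewrite -[F]L2classK L2mulE; apply: L2class_node_values.
rewrite Phat_comb_values Phat_coefE.
set f := node_values _.
have trE : PC^T *m H4 N gamma delta =
    diag_mx (map_mx RtoC (eigval_row N gamma delta)) *m PC^T.
  by rewrite -H4_sym -trmx_mul H4_eigen trmx_mul tr_diag_mx.
rewrite [LHS]mulmxA trE -mulmxA.
have -> : PC^T *m (PC *m (MC *m f)) = f.
  by rewrite mulmxA mulmxA -[PC^T *m _ *m _]mulmxA PC_completeness mul1mx.
apply/colP => x; rewrite mul_diag_mx !mxE /= h4_funE //.
by rewrite -ltnS.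
Qed.

(** * The spectrum *)

Lemma PC_unit : PC \in unitmx.
Proof. by case/mulmx1_unit: PC_orthonormality. Qed.

Lemma spec_H4 : spec (H4 N gamma delta) =
  [set z | exists2 x, (x <= N)%N &
    z = (gbinom (2 * N%:R + gamma + delta + 1) x)%:C].
Proof.
have H4E : H4 N gamma delta =
    PC *m diag_mx (map_mx RtoC (eigval_row N gamma delta)) *m invmx PC.
  by rewrite -H4_eigen mulmxK // PC_unit.
have shiftE z : z%:M - H4 N gamma delta =
    PC *m diag_mx (\row_x (z - (eigval N gamma delta x)%:C)) *m invmx PC.
  rewrite H4E -[z%:M](mulmxK PC_unit) -mulmxBl; congr (_ *m _).
  rewrite -scalar_mxC -mulmxBr; congr (_ *m _).
  rewrite -diag_const_mx -raddfB; congr diag_mx.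
  by apply/rowP => x; rewrite !mxE.
have unitE z : (z%:M - H4 N gamma delta \in unitmx) =
    [forall x : 'I_N.+1, z != (eigval N gamma delta x)%:C].
  rewrite shiftE !unitmx_mul unitmx_inv PC_unit andbT /= unitmxE det_diag.
  rewrite unitfE; apply/prodf_neq0/forallP => H x.
    by have := H x isT; rewrite mxE subr_eq0.
  by move=> _; rewrite mxE subr_eq0.
apply/seteqP; split => z; rewrite /spec /= unitE negb_forall.
  move=> /existsP[x]; rewrite negbK => /eqP ->.
  by exists (N - x)%N => //; exact: leq_subr.
move=> [k kN ->]; apply/existsP.
have xN : (N - k < N.+1)%N by rewrite ltnS leq_subr.
by exists (Ordinal xN); rewrite negbK /eigval /= subKn.
Qed.

End MultiplicationModel.

Theorem theorem7 (R : realType) (N : nat) (gamma delta : R)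
    (gamma_gt : -1 < gamma) (delta_gt : -1 < delta) :
  (exists (U : {linear 'cV[R[i]]_N.+1 -> L2 (mu4 N gamma_gt delta_gt)})
          (Uinv : L2 (mu4 N gamma_gt delta_gt) -> 'cV[R[i]]_N.+1),
     [/\ forall n : 'I_N.+1,
           U (delta_mx n 0) = Phat N gamma_gt delta_gt n,
         cancel U Uinv /\ cancel Uinv U,
         forall u v : 'cV[R[i]]_N.+1, L2dot (U u) (U v) = cdot u v
       & forall F : L2 (mu4 N gamma_gt delta_gt),
           U (H4 N gamma delta *m Uinv F) = L2mul (h4 N gamma delta) F]) /\
  spec (H4 N gamma delta) =
    [set z : R[i] | exists2 x : nat, (x <= N)%N &
       z = (gbinom (2 * N%:R + gamma + delta + 1) x)%:C].

Proof.
split; last exact: spec_H4.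
exists (@Phat_map R N gamma delta gamma_gt delta_gt : {linear _ -> _}).
exists (@Phat_coef R N gamma delta gamma_gt delta_gt); split.
- exact: Phat_map_delta.
- by split; [exact: Phat_mapK | exact: Phat_coefK].
- exact: Phat_map_isometry.
- exact: Phat_map_intertwines.
Qed.
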